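(* Let $X$ be a metric space with a bicombing $\Gamma$. Then the following are equivalent: (1) there is a Banach space $B$ and an injective isometric $\Gamma$-affine map $f:X\to B$; (2) the $\Gamma$-affine functions $X\to\mathbb{R}$ separate the points of $X$ (for all $x\neq\bar x$ in $X$ there is a $\Gamma$-affine $f:X\to\mathbb{R}$ with $f(x)\neq f(\bar x)$); (3) there is a Banach space $B$ and an injective $\Gamma$-affine map $f:X\to B$.
   Context: A geodesic is an isometric embedding of an interval (arclength parametrized). A bicombing $\Gamma$ on a metric space $X$ assigns to each pair of points $x,y\in X$ a geodesic $\gamma_{xy}$ from $x$ to $y$ such that $\gamma_{yx}$ is $\gamma_{xy}$ with reversed orientation, and such that for every point $m$ on $\gamma_{xy}$ the geodesic $\gamma_{my}$ is the corresponding part of $\gamma_{xy}$ (no continuity in $x,y$ is required). Every normed vector space (in particular every Banach space and $\mathbb{R}$) is equipped with the natural bicombing $\gamma_{xy}(t)=x+t\frac{y-x}{\|y-x\|}$. A map $F:X\to Y$ between spaces with bicombings (both denoted $\Gamma$) is $\Gamma$-affine if for all $x,\bar x\in X$ there are numbers $a,b$ such that $F(\gamma_{x\bar x}(t))=\gamma_{F(x)F(\bar x)}(at+b)$ for all $t$ in the domain of $\gamma_{x\bar x}$. A $\Gamma$-affine function is a $\Gamma$-affine map $X\to\mathbb{R}$. *)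

(* Defs.v *)
From HB Require Import structures.
From mathcomp Require Import all_boot all_order all_algebra.
From mathcomp Require Import all_classical all_reals all_analysis.
Set Implicit Arguments. Unset Strict Implicit. Unset Printing Implicit Defensive.
Import Order.TTheory GRing.Theory Num.Theory.
Import numFieldNormedType.Exports.
Local Open Scope ring_scope.

Section Defs.
Variable R : realType.

Definition is_metric (X : Type) (d : X -> X -> R) : Prop :=
  (forall x y, 0 <= d x y) /\
  (forall x y, d x y = 0 <-> x = y) /\
  (forall x y, d x y = d y x) /\
  (forall x y z, d x z <= d x y + d y z).

(* A bicombing: g x y : R -> X is the geodesic gamma_{xy}, whose domain is
   the interval [0, d x y]; values outside the domain are irrelevant. *)
Definition is_bicombing (X : Type) (d : X -> X -> R) (g : X -> X -> R -> X)
  : Prop :=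
  (forall x y, g x y 0 = x /\ g x y (d x y) = y) /\
  (forall x y s t, 0 <= s <= d x y -> 0 <= t <= d x y ->
      d (g x y s) (g x y t) = `|s - t|) /\
  (forall x y t, 0 <= t <= d x y -> g y x t = g x y (d x y - t)) /\
  (forall x y s t, 0 <= s <= d x y -> 0 <= t <= d x y - s ->
      g (g x y s) y t = g x y (s + t)).

Definition affine_map (X Y : Type) (dX : X -> X -> R) (gX : X -> X -> R -> X)
  (dY : Y -> Y -> R) (gY : Y -> Y -> R -> Y) (F : X -> Y) : Prop :=
  forall x x', exists a b : R, forall t, 0 <= t <= dX x x' ->
    0 <= a * t + b <= dY (F x) (F x') /\
    F (gX x x' t) = gY (F x) (F x') (a * t + b).

Definition norm_dist (V : normedModType R) (u v : V) : R := `|u - v|.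

Definition natural_bicombing (V : normedModType R) (u v : V) (t : R) : V :=
  u + (t / `|v - u|) *: (v - u).

End Defs.

(* Main.v *)
Require Import Defs.
From HB Require Import structures.
From mathcomp Require Import all_boot all_order all_algebra.
From mathcomp Require Import all_classical all_reals all_analysis.
From mathcomp Require Import ring lra.
Import Order.TTheory GRing.Theory Num.Theory.
Import numFieldNormedType.Exports.
Set Implicit Arguments. Unset Strict Implicit. Unset Printing Implicit Defensive.
Local Open Scope classical_set_scope.
Local Open Scope ring_scope.

(* A map into a normed space is affine iff it maps the point of parameter s d(x,y)
   on the geodesic xy to F x + s (F y - F x). If affine functions separate points,
   evaluation embeds X as a convex set in the vector space of functions on the
   affine functions, and d becomes a metric for which straight segments are
   geodesics of constant speed. Such a metric is translation invariant: for two
   parallel segments xx' and yy', let D(a,b) be the distance between their points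
   at parameters a and b. The midpoint trick gives
   2 D(a,b) <= D(a,b+e) + D(a+e,b) for e of either sign, so iterating along a
   random walk D(a,a) <= E D(a+ie,a+(n-i)e) with i binomial; as D is Lipschitz,
   concentration yields D(a,a) <= D(a+c,a+c) whenever a+2c lies in [0,1], and
   hence D is constant on the diagonal. So d comes from a norm on the span of
   the differences, and the Hahn-Banach theorem provides, for each pair of points, a
   1-Lipschitz affine function attaining their distance; these functions are the
   coordinates of an isometric affine map into a space of bounded functions.
   Conversely, Hahn-Banach functionals on a Banach space separate points. *)

(** * The Banach space of bounded functions with the supremum norm *)

Definition bounded_function {R : realType} {S : Type} : pred (S -> R) :=
  fun f => `[< exists M, forall s, `|f s| <= M >].

Section BoundedFunctions.
Context {R : realType} {S : Type}.
Local Notation bf := (@bounded_function R S).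

Lemma bounded_function_submod : GRing.submod_closed bf.
Proof.
split; first by apply/asboolP; exists 0 => s; rewrite normr0.
move=> a f h /asboolP[M fM] /asboolP[N hN]; apply/asboolP.
exists (`|a| * M + N) => s.
by rewrite (le_trans (ler_normD _ _))// lerD// normrM ler_wpM2l.
Qed.

HB.instance Definition _ := GRing.isSubmodClosed.Build R (S -> R) bf
  bounded_function_submod.

Definition ell_infty : Type := {f : S -> R | bf f}.
HB.instance Definition _ := [isSub of ell_infty for @sval _ _].
HB.instance Definition _ := [Choice of ell_infty by <:].
HB.instance Definition _ := [SubChoice_isSubLmodule of ell_infty by <:].

(* [0] belongs to the set so that the supremum is also correct for empty [S]. *)
Definition sup_norm (f : ell_infty) : R :=
  sup [set r | r = 0 \/ exists s, r = `|val f s|].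

Lemma sup_norm_ub (f : ell_infty) s : `|val f s| <= sup_norm f.
Proof.
have /asboolP[M fM] := valP f; apply: ub_le_sup; last by right; exists s.
exists (Num.max 0 M) => _ [->|[t ->]]; rewrite le_max ?lexx//.
by rewrite fM orbT.
Qed.

Lemma sup_norm_le (f : ell_infty) M :
  0 <= M -> (forall s, `|val f s| <= M) -> sup_norm f <= M.
Proof.
move=> M0 fM; apply: ge_sup; first by exists 0; left.
by move=> _ [->|[s ->]].
Qed.

Lemma sup_norm_ge0 f : 0 <= sup_norm f.
Proof.
have /asboolP[M fM] := valP f; apply: ub_le_sup; last by left.
exists (Num.max 0 M) => _ [->|[t ->]]; rewrite le_max ?lexx//.
by rewrite fM orbT.
Qed.

Lemma sup_normD f h : sup_norm (f + h) <= sup_norm f + sup_norm h.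
Proof.
apply: sup_norm_le => [|s]; first by rewrite addr_ge0 ?sup_norm_ge0.
by rewrite (le_trans (ler_normD _ _))// lerD// sup_norm_ub.
Qed.

Lemma sup_normZ a f : sup_norm (a *: f) = `|a| * sup_norm f.
Proof.
have le_scale c h : sup_norm (c *: h) <= `|c| * sup_norm h.
  apply: sup_norm_le => [|s]; first by rewrite mulr_ge0 ?sup_norm_ge0.
  by rewrite normrM ler_wpM2l// sup_norm_ub.
apply/eqP; rewrite eq_le le_scale /=; have [->|a0] := eqVneq a 0.
  by rewrite normr0 mul0r sup_norm_ge0.
rewrite -ler_pdivlMl ?normr_gt0// -normfV.
by have := le_scale a^-1 (a *: f); rewrite scalerA mulVf// scale1r.
Qed.

Lemma sup_norm0_eq0 f : sup_norm f = 0 -> f = 0.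
Proof.
move=> f0; apply/val_inj/funext => s; apply/normr0_eq0/eqP.
by rewrite eq_le normr_ge0 andbT -f0 sup_norm_ub.
Qed.

HB.instance Definition _ := Lmodule_isNormed.Build R ell_infty
  sup_normD sup_normZ sup_norm0_eq0.

(** Coordinates of a Cauchy filter converge in [R]. Estimates [|h s - f s| <= e] pass to the limit
    with the same [e] for all [s], so the pointwise limit is bounded and uniform. *)
Lemma ell_infty_complete (F : set_system ell_infty) :
  ProperFilter F -> cauchy F -> cvg F.
Proof.
move=> FF /cauchyP Fc.
have distE (f h : ell_infty) e s : ball f e h -> `|val f s - val h s| <= e.
  rewrite -ball_normE /= => /ltW; apply: le_trans.
  exact: (sup_norm_ub (f - h)).
pose ev s (f : ell_infty) : R := val f s.
have evc s : cvg (ev s @ F).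
  apply/cauchy_cvgP/cauchyP => _/posnumP[e].
  have [f Ff] := Fc (e%:num / 2) ltac:(by []).
  exists (ev s f); rewrite /fmap /=; apply: filterS Ff => h /(distE _ _ _ s) fh.
  by rewrite -ball_normE /= (le_lt_trans fh)// ltr_pdivrMr// ltr_pMr// ltr1n.
pose l s : R := lim (ev s @ F).
have lP f e : F (ball f e) -> forall s, `|l s - val f s| <= e.
  move=> Ff s; rewrite ler_distl; apply/andP; split.
    rewrite /l; apply: limr_ge; first exact: evc.
    apply: filterS Ff => h /(distE _ _ _ s).
    by rewrite /ev ler_distlC => /andP[].
  rewrite /l; apply: limr_le; first exact: evc.
  apply: filterS Ff => h /(distE _ _ _ s).
  by rewrite /ev ler_distlC => /andP[].
have lb : bf l.
  have [f Ff] := Fc 1 ltr01; apply/asboolP; exists (1 + sup_norm f) => s.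
  rewrite -[l s](subrK (val f s)) (le_trans (ler_normD _ _))// lerD//.
    exact: lP.
  exact: sup_norm_ub.
apply/cvg_ex; exists (Sub l lb : ell_infty); apply/cvgrPdist_le => _/posnumP[e].
have [f Ff] := Fc (e%:num / 2) ltac:(by []).
apply: filterS (Ff) => h fh; apply: sup_norm_le => // s /=.
rewrite [e%:num]splitr (le_trans (ler_distD (val f s) _ _))// lerD//.
  exact: lP.
exact: distE.
Qed.

HB.instance Definition _ := Uniform_isComplete.Build ell_infty
  ell_infty_complete.

End BoundedFunctions.
Arguments ell_infty : clear implicits.

(** * Hahn-Banach theorem for sublinear functionals on a subspace *)

Section HahnBanach.
Context {R : realType} {V : lmodType R}.
Variable W : set V.
Hypothesis W_add : forall u v, W u -> W v -> W (u + v).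
Hypothesis W_scale : forall (a : R) u, W u -> W (a *: u).

Definition sublinear_on (q : V -> R) : Prop :=
  (forall u v, W u -> W v -> q (u + v) <= q u + q v) /\
  (forall (a : R) u, 0 <= a -> W u -> q (a *: u) <= a * q u).

Let W_opp u : W u -> W (- u).
Proof. by move=> Wu; rewrite -scaleN1r; exact: W_scale. Qed.

Lemma sublinear_on0 q u : sublinear_on q -> W u -> q 0 = 0.
Proof.
move=> [qD qZ] Wu; have W0 : W 0 by rewrite -(scale0r u); exact: W_scale.
have := qZ 0 0 (lexx 0) W0; have := qD 0 0 W0 W0.
by rewrite scale0r mul0r addr0; lra.
Qed.

Lemma sublinear_onN q u : sublinear_on q -> W u -> - q (- u) <= q u.
Proof.
move=> qs Wu; have [qD _] := qs.
by have := qD _ _ Wu (W_opp Wu); rewrite subrr (sublinear_on0 qs Wu); lra.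
Qed.

Lemma sublinear_onZ q a u :
  sublinear_on q -> 0 <= a -> W u -> q (a *: u) = a * q u.
Proof.
move=> qs; rewrite le0r => /predU1P[->|a0] Wu.
  by rewrite scale0r mul0r (sublinear_on0 qs Wu).
have [_ qZ] := qs; apply/eqP; rewrite eq_le qZ ?(ltW a0)//=.
have := qZ a^-1 (a *: u); rewrite invr_ge0 ltW// => /(_ isT (W_scale _ Wu)).
by rewrite scalerA mulVf ?gt_eqF// scale1r ler_pdivlMl.
Qed.

(* Covers the infimum of a chain of sublinear functionals and that of
   [q (x + t *: y) - t * q y] over [t >= 0]. *)
Lemma sublinear_on_inf (S : V -> set R) :
  (forall u, W u -> (exists a, S u a) /\ exists m, forall a, S u a -> m <= a) ->
  (forall u v a b, W u -> W v -> S u a -> S v b ->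
     exists2 c, S (u + v) c & c <= a + b) ->
  (forall u a (l : R), W u -> 0 <= l -> S u a -> exists2 c, S (l *: u) c & c <= l * a) ->
  sublinear_on (fun u => inf (S u)).
Proof.
move=> S_ok SD SZ.
have infle u a : W u -> S u a -> inf (S u) <= a.
  by move=> /S_ok[_ [m mS]] Sa; apply: ge_inf => //; exists m => b /mS.
split=> [u v Wu Wv|l u l0 Wu].
  rewrite /= -lerBlDr; apply: lb_le_inf; first by have [] := S_ok _ Wu.
  move=> a Sa; rewrite lerBlDr -lerBlDl.
  apply: lb_le_inf; first by have [] := S_ok _ Wv.
  move=> b Sb; have [c Sc cab] := SD _ _ _ _ Wu Wv Sa Sb.
  by have := infle _ _ (W_add Wu Wv) Sc; lra.
have [[a0 Sa0] _] := S_ok _ Wu.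
have le_inf a : S u a -> inf (S (l *: u)) <= l * a.
  by move=> /(SZ _ _ _ Wu l0)[c Sc]; apply: le_trans; exact: infle (W_scale _ Wu) Sc.
move: l0 le_inf; rewrite le0r => /predU1P[->|l0] le_inf.
  by have := le_inf _ Sa0; rewrite !mul0r.
rewrite -ler_pdivrMl//; apply: lb_le_inf; first by exists a0.
by move=> a /le_inf; rewrite ler_pdivrMl.
Qed.

(** For sublinear [q], taking [t = 0] shows that this lies below [q], and [t = 1] that its value at
    [- y] is at most [- q y]: it pushes [q] towards linearity along [y]. *)
Definition descent (q : V -> R) (y x : V) : R :=
  inf [set r | exists2 t : R, 0 <= t & r = q (x + t *: y) - t * q y].

Lemma sublinear_on_descent q y : sublinear_on q -> W y ->
  sublinear_on (descent q y) /\
  forall x t, W x -> 0 <= t -> descent q y x <= q (x + t *: y) - t * q y.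
Proof.
move=> qs Wy; have [qD qZ] := qs.
have bnd x t : W x -> 0 <= t -> - q (- x) <= q (x + t *: y) - t * q y.
  move=> Wx t0; rewrite -(sublinear_onZ qs t0 Wy).
  have := qD (x + t *: y) (- x) (W_add Wx (W_scale _ Wy)) (W_opp Wx).
  by rewrite addrAC subrr add0r; lra.
split; last first.
  move=> x t Wx t0; apply: ge_inf; last by exists t.
  by exists (- q (- x)) => _ [s s0 ->]; exact: bnd.
apply: sublinear_on_inf.
- move=> x Wx; split; first by exists (q (x + 0 *: y) - 0 * q y), 0.
  by exists (- q (- x)) => _ [s s0 ->]; exact: bnd.
- move=> u v _ _ Wu Wv [s s0 ->] [t t0 ->].
  exists (q (u + v + (s + t) *: y) - (s + t) * q y).
    by exists (s + t) => //; exact: addr_ge0.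
  have := qD _ _ (W_add Wu (W_scale s Wy)) (W_add Wv (W_scale t Wy)).
  by rewrite addrACA scalerDl; lra.
- move=> u _ l Wu l0 [t t0 ->].
  exists (q (l *: u + (l * t) *: y) - (l * t) * q y).
    by exists (l * t) => //; exact: mulr_ge0.
  have := qZ l _ l0 (W_add Wu (W_scale t Wy)).
  by rewrite scalerDr scalerA mulrBr mulrA; lra.
Qed.

(** Zorn's lemma for the reversed pointwise order: sublinear functionals below [p] are at least
    [- p (- u)] at [u], so a nonempty chain has a pointwise infimum, again sublinear. *)
Lemma minimal_sublinear p : sublinear_on p ->
  exists q, [/\ sublinear_on q, forall v, W v -> q v <= p v &
    forall r, sublinear_on r -> (forall v, W v -> r v <= q v) ->
      forall v, W v -> r v = q v].
Proof.
move=> ps.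
(* Vanishing outside [W] makes the pointwise order on [T] antisymmetric. *)
pose T := {q : V -> R | [/\ sublinear_on q, forall v, W v -> q v <= p v &
  forall v, ~ W v -> q v = 0]}.
pose ge (q r : T) := forall v, W v -> sval r v <= sval q v.
pose cut (q : V -> R) v := if pselect (W v) then q v else 0.
have cutE q v : W v -> cut q v = q v by rewrite /cut; case: pselect.
have cut0 q v : ~ W v -> cut q v = 0 by rewrite /cut; case: pselect.
have cut_sub q : sublinear_on q -> sublinear_on (cut q).
  move=> [qD qZ]; split=> [u v Wu Wv|a u a0 Wu].
    by rewrite !cutE//; [exact: qD|exact: W_add].
  by rewrite !cutE//; [exact: qZ|exact: W_scale].
have cut_le q : (forall v, W v -> q v <= p v) -> forall v, W v -> cut q v <= p v.
  by move=> qp v Wv; rewrite cutE//; exact: qp.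
pose mk q (qs : sublinear_on q) qp : T :=
  exist _ (cut q) (And3 (cut_sub q qs) (cut_le q qp) (cut0 q)).
have [||||q qmin] := @Zorn T (fun q r => `[< ge q r >]).
- by move=> q; apply/asboolP => v _.
- move=> q r s /asboolP qr /asboolP rs; apply/asboolP => v Wv.
  exact: le_trans (rs v Wv) (qr v Wv).
- move=> [q [q1 q2 q3]] [r [r1 r2 r3]] /asboolP qr /asboolP rq; apply/eq_exist/funext => v.
  have [Wv|nWv] := pselect (W v); last by rewrite q3// r3.
  by apply/eqP; rewrite eq_le (qr v Wv) (rq v Wv).
- move=> A Atot; have [->|/set0P[q0 Aq0]] := eqVneq A set0.
    by exists (mk p ps (fun v _ => lexx (p v))) => s.
  pose S v := [set sval q v | q in A].
  have Slb u a : W u -> S u a -> - p (- u) <= a.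
    move=> Wu [q _ <-]; case: q => q [qs qp _] /=.
    by have := sublinear_onN qs Wu; have := qp _ (W_opp Wu); lra.
  have rs : sublinear_on (fun u => inf (S u)).
    apply: sublinear_on_inf.
    - move=> u Wu; split; first by exists (sval q0 u), q0.
      by exists (- p (- u)) => a; exact: Slb.
    (* In a chain, the smaller of two functionals serves both summands. *)
    - have key q r u v : A q -> W u -> W v -> ge q r -> A r ->
          exists2 c, S (u + v) c & c <= sval q u + sval r v.
        move=> Aq Wu Wv qr Ar; exists (sval r (u + v)); first by exists r.
        have := qr _ Wu; case: (r) => r' [[rD _] _ _] /= ru.
        by have := rD _ _ Wu Wv; lra.
      move=> u v _ _ Wu Wv [q Aq <-] [r Ar <-].
      have [/asboolP qr|/asboolP rq] := Atot q r Aq Ar; first exact: key.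
      by rewrite addrC [_ + sval r v]addrC; exact: key.
    - move=> u _ l Wu l0 [q Aq <-]; exists (sval q (l *: u)); first by exists q.
      by case: (q) => q' [[_ qZ] _ _] /=; exact: qZ.
  have rle q v : A q -> W v -> inf (S v) <= sval q v.
    move=> Aq Wv; apply: ge_inf; last by exists q.
    by exists (- p (- v)) => a; exact: Slb.
  have rp v : W v -> inf (S v) <= p v.
    move=> Wv; apply: le_trans (rle q0 v Aq0 Wv) _.
    by case: (q0) => q' [_ qp _] /=; exact: qp.
  exists (mk _ rs rp) => q Aq; apply/asboolP => v Wv /=.
  by rewrite cutE//; exact: rle.
have [qs qp _] := svalP q; exists (sval q); split => // r rs rq v Wv.
have rp u : W u -> r u <= p u by move=> Wu; apply: le_trans (rq u Wu) (qp u Wu).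
have -> : q = mk r rs rp by apply/esym/qmin; apply/asboolP => u Wu /=; rewrite cutE//; exact: rq.
by rewrite /= cutE.
Qed.

Theorem hahn_banach p v0 : sublinear_on p -> W v0 ->
  exists l : V -> R, [/\ forall u v, W u -> W v -> l (u + v) = l u + l v,
    forall (a : R) u, W u -> l (a *: u) = a * l u,
    forall u, W u -> l u <= p u & l v0 = p v0].
Proof.
(* Any sublinear [l <= descent p v0] satisfies [l (- v0) <= - p v0]; a minimal
   one equals all its descents, which makes it additive. *)
move=> ps Wv0; have [p1s p1le] := sublinear_on_descent ps Wv0.
have [l [ls lp1 lmin]] := minimal_sublinear p1s.
have lD u v : W u -> W v -> l (u + v) = l u + l v.
  move=> Wu Wv; have [ds dle] := sublinear_on_descent ls Wv.
  have dl x : W x -> descent l v x = l x.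
    apply: lmin => // y Wy.
    by have := dle y 0 Wy (lexx 0); rewrite scale0r mul0r addr0 subr0.
  have := dle u 1 Wu ler01; rewrite dl// scale1r mul1r.
  by have [/(_ u v Wu Wv)] := ls; lra.
have lN u : W u -> l (- u) = - l u.
  move=> Wu; have := lD _ _ Wu (W_opp Wu).
  by rewrite subrr (sublinear_on0 ls Wu); lra.
have lp u : W u -> l u <= p u.
  move=> Wu; apply: le_trans (lp1 u Wu) _.
  by have := p1le u 0 Wu (lexx 0); rewrite scale0r mul0r addr0 subr0.
exists l; split => //.
- move=> a u Wu; have [a0|a0] := leP 0 a; first exact: sublinear_onZ.
  have := sublinear_onZ ls (_ : 0 <= - a) Wu; rewrite oppr_ge0 ltW// => /(_ isT).
  by rewrite scaleNr lN//; [lra|exact: W_scale].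
- apply/eqP; rewrite eq_le lp//= -lerN2 -lN//.
  have := lp1 _ (W_opp Wv0); have := p1le (- v0) 1 (W_opp Wv0) ler01.
  by rewrite scale1r mul1r addNr (sublinear_on0 ps Wv0); lra.
Qed.

End HahnBanach.

(** * Random walks and constancy on the diagonal *)

Lemma ler_addinv_nat (R : realType) (x y K : R) :
  (forall k : nat, x <= y + K / k.+1%:R) -> x <= y.
Proof.
move=> H; apply/ler_addgt0Pr => e e0.
have [k Kk] : exists k : nat, K / k.+1%:R <= e.
  exists (Num.truncn (K / e)); rewrite ler_pdivrMr// mulrC -ler_pdivrMr//.
  by rewrite ltW// truncnS_gt.
exact: le_trans (H k) (lerD (lexx y) Kk).
Qed.

Section DiagonalConstancy.
Context {R : realType}.
Variables (D : R -> R -> R) (C : R).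
Let I (t : R) := 0 <= t <= 1.
Hypothesis D_step : forall a b e, I a -> I b -> I (a + e) -> I (b + e) ->
  2 * D a b <= D a (b + e) + D (a + e) b.
Hypothesis D_lip : forall a b a' b', I a -> I b -> I a' -> I b' ->
  D a b <= D a' b' + C * (`|a - a'| + `|b - b'|).
Hypothesis C_ge0 : 0 <= C.


Let I_between a b s : I a -> I b -> I s -> I (a + s * (b - a)).
Proof.
rewrite /I => /andP[a0 a1] /andP[b0 b1] /andP[s0 s1].
have -> : a + s * (b - a) = (1 - s) * a + s * b by ring.
have s1' : 0 <= 1 - s by rewrite subr_ge0.
rewrite addr_ge0 ?mulr_ge0//= -[leRHS](subrK s) lerD//.
  by rewrite -[leRHS]mulr1 ler_wpM2l.
by rewrite -[leRHS]mulr1 ler_wpM2l.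
Qed.

(* [(i - j)^2 + k] is preserved on average by the two moves
   [i -> i + 1] and [j -> j + 1] of the walk. *)
Lemma random_walk_bound a e (M : R) (n i j k : nat) :
  0 < M -> I a -> I (a + n%:R * e) -> (i + j + k = n)%N ->
  D (a + i%:R * e) (a + j%:R * e) <=
  D (a + n%:R * e / 2) (a + n%:R * e / 2)
  + C * `|e| * (((i%:R - j%:R) ^+ 2 + k%:R) / M + M) / 2.
Proof.
move=> M0 Ia Ian.
have Ii l : (l <= n)%N -> I (a + l%:R * e).
  case: n Ian => [_|n Ian lm]; first by rewrite leqn0 => /eqP->; rewrite mul0r addr0.
  have n0 : n.+1%:R != 0 :> R by rewrite pnatr_eq0.
  have -> : a + l%:R * e = a + (l%:R / n.+1%:R) * ((a + n.+1%:R * e) - a).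
    by field.
  apply: I_between => //; rewrite /I divr_ge0 ?ler0n//=.
  by rewrite ler_pdivrMr ?ltr0n// mul1r ler_nat.
have Ihalf : I (a + n%:R * e / 2).
  have -> : a + n%:R * e / 2 = a + 2^-1 * ((a + n%:R * e) - a) by field.
  by apply: I_between => //; rewrite /I invr_ge0 ler0n invf_le1 ?ler1n ?ltr0n.
elim: k i j => [|k IH] i j.
  rewrite addn0 => ijn; apply: le_trans (D_lip _ _ Ihalf Ihalf) _.
  - by apply: Ii; rewrite -ijn leq_addr.
  - by apply: Ii; rewrite -ijn leq_addl.
  rewrite lerD2l -!mulrA ler_wpM2l//.
  rewrite -ijn natrD; set x : R := i%:R; set y : R := j%:R.
  have -> : a + x * e - (a + (x + y) * (e / 2)) = e * ((x - y) / 2) by field.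
  have -> : a + y * e - (a + (x + y) * (e / 2)) = - (e * ((x - y) / 2)) by field.
  rewrite normrN normrM -mulrDr ler_wpM2l//.
  rewrite normrM (@ger0_norm _ 2^-1) ?invr_ge0// -mulrDl ler_pM2r ?invr_gt0//.
  (* By [2 z <= z^2 / M + M], a square replaces the absolute value; its mean under the walk is
     explicit. *)
  rewrite addr0 -subr_ge0 -real_normK ?num_real//; set z := `|x - y|.
  have -> : z ^+ 2 / M + M - (z + z) = (z - M) ^+ 2 / M by field; exact: lt0r_neq0.
  by rewrite divr_ge0 ?sqr_ge0 ?ltW.
move=> ijkn; have Ie l : (l < n)%N -> I (a + l%:R * e + e).
  by move=> ln; have := Ii _ ln; rewrite -natr1 mulrDl mul1r addrA.
have lin : (i < n)%N by rewrite -ijkn addnS ltnS -addnA leq_addr.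
have ljn : (j < n)%N by rewrite -ijkn addnS ltnS -addnA addnCA leq_addr.
have := D_step (Ii _ (ltnW lin)) (Ii _ (ltnW ljn)) (Ie _ lin) (Ie _ ljn).
have := IH i j.+1; have := IH i.+1 j.
rewrite addSnnS addnS addSn -addnS => /(_ ijkn) + /(_ ijkn).
rewrite -!natr1 !mulrDl !mul1r !addrA.
by lra.
Qed.

(** The walk has [n = (k + 1)^2] steps of size [e = 2 c / n], so its midpoint is [a + c]. With
    [M = k + 1], the square root of [n], the error is [2 C |c| / (k + 1)], which tends to [0]. *)
Lemma diagonal_le a c : I a -> I (a + 2 * c) -> D a a <= D (a + c) (a + c).
Proof.
move=> Ia Iac; apply: (@ler_addinv_nat _ _ _ (2 * C * `|c|)) => k.
have M0 : 0 < k.+1%:R :> R by rewrite ltr0n.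
pose e := 2 * c / (k.+1%:R * k.+1%:R).
have neE : (k.+1 * k.+1)%:R * e = 2 * c.
  by rewrite natrM /e mulrC divfK// mulf_neq0 ?gt_eqF.
have := @random_walk_bound a e k.+1%:R (k.+1 * k.+1) 0 0 (k.+1 * k.+1) M0 Ia.
rewrite neE => /(_ Iac erefl); rewrite !mul0r !addr0.
have -> : 2 * c / 2 = c by field.
move/le_trans; apply; rewrite lerD2l subr0 expr0n add0r natrM mulfK ?gt_eqF//.
rewrite /e normrM normfV (normrM 2 c) (@ger0_norm _ 2)//.
rewrite (@ger0_norm _ (_ * _)) ?mulr_ge0 ?ler0n//.
by rewrite le_eqVlt; apply/orP; left; apply/eqP; field; exact: lt0r_neq0.
Qed.

(** The walks run from [t] to [0], with midpoint [t / 2], and from [t / 2] to [3 t / 2], with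
    midpoint [t]; the bound on [t] keeps the latter inside the interval. *)
Lemma diagonal_half t : 0 <= t <= 2^-1 -> D t t = D (t / 2) (t / 2).
Proof.
move=> /andP[t0 t1]; apply/eqP; rewrite eq_le; apply/andP; split.
  have := @diagonal_le t (- (t / 2)).
  have -> : t + 2 * - (t / 2) = 0 by field.
  have -> : t - t / 2 = t / 2 by field.
  by apply; rewrite /I; lra.
have := @diagonal_le (t / 2) (t / 2).
by rewrite -splitr; apply; rewrite /I; lra.
Qed.

(** Repeated halving leads from [2^-1] to [2^-1 ^+ k.+1], and the Lipschitz bound in both variables
    compares that point with [0] up to [2 C / (k + 1)]. *)
Lemma diagonal_at0 : D 0 0 = D 2^-1 2^-1.
Proof.
have I0 : I 0 by rewrite /I lexx ler01.
have pow_le k : 0 <= (2^-1 : R) ^+ k.+1 <= 2^-1.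
  by rewrite exprn_ge0 ?invr_ge0//= exprS ger_pMr ?invr_gt0// exprn_ile1 ?invr_ge0// invf_le1 ?ler1n ?ltr0n.
have powE k : D 2^-1 2^-1 = D (2^-1 ^+ k.+1) (2^-1 ^+ k.+1).
  elim: k => [|k ->]; first by rewrite expr1.
  by rewrite diagonal_half// -exprSr.
have pow_inv k : (2^-1 : R) ^+ k.+1 <= k.+1%:R^-1.
  by rewrite exprVn lef_pV2 ?posrE ?exprn_gt0 ?ltr0n// -natrX ler_nat ltnW// ltn_expl.
have Ipow k : I (2^-1 ^+ k.+1) by have := pow_le k; rewrite /I; lra.
apply/eqP; rewrite eq_le; apply/andP; split; apply: (@ler_addinv_nat _ _ _ (2 * C)) => k.
  rewrite (powE k); apply: le_trans (D_lip I0 I0 (Ipow k) (Ipow k)) _.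
  rewrite lerD2l sub0r normrN ger0_norm; last by have /andP[] := pow_le k.
  by rewrite -mulrA mulrCA ler_wpM2l// -mulr2n -[leLHS]mulr_natl ler_wpM2l.
rewrite (powE k); apply: le_trans (D_lip (Ipow k) (Ipow k) I0 I0) _.
rewrite lerD2l subr0 ger0_norm; last by have /andP[] := pow_le k.
by rewrite -mulrA mulrCA ler_wpM2l// -mulr2n -[leLHS]mulr_natl ler_wpM2l.
Qed.

End DiagonalConstancy.

(** The reversal [a -> 1 - a] preserves both hypotheses, [e] being of either sign, so both ends of
    the diagonal agree with its midpoint. *)
Lemma diagonal_const (R : realType) (D : R -> R -> R) (C : R) :
  (forall a b e : R, 0 <= a <= 1 -> 0 <= b <= 1 -> 0 <= a + e <= 1 ->
    0 <= b + e <= 1 -> 2 * D a b <= D a (b + e) + D (a + e) b) ->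
  (forall a b a' b' : R, 0 <= a <= 1 -> 0 <= b <= 1 -> 0 <= a' <= 1 ->
    0 <= b' <= 1 -> D a b <= D a' b' + C * (`|a - a'| + `|b - b'|)) ->
  0 <= C -> D 0 0 = D 1 1.
Proof.
move=> step lip C0; rewrite (diagonal_at0 step lip C0).
have I_rev (a : R) : 0 <= a <= 1 -> 0 <= 1 - a <= 1 by lra.
have := @diagonal_at0 R (fun a b => D (1 - a) (1 - b)) C.
rewrite subr0 (_ : 1 - 2^-1 = 2^-1); last by field.
move=> ->// => [a b e Ia Ib Iae Ibe|a b a' b' Ia Ib Ia' Ib'].
  have := @step (1 - a) (1 - b) (- e) (I_rev _ Ia) (I_rev _ Ib).
  by rewrite -!addrA -!opprD; apply; exact: I_rev.
have := lip _ _ _ _ (I_rev _ Ia) (I_rev _ Ib) (I_rev _ Ia') (I_rev _ Ib').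
have E (x y : R) : `|1 - x - (1 - y)| = `|x - y| by rewrite distrC; congr `|_|; ring.
by rewrite !E.
Qed.

(** * The norm induced by [d] on the span of differences *)

(* [ev] embeds [X] in the vector space [A -> R], and [m x y] is the segment
   from [x] to [y] parametrized by [0, 1]. *)
Section AffineMetric.
Context {R : realType} {X A : Type}.
Variables (d : X -> X -> R) (m : X -> X -> R -> X) (ev : X -> A -> R).
Hypothesis d_metric : is_metric d.
Hypothesis d_seg : forall x y (s t : R), 0 <= s <= 1 -> 0 <= t <= 1 ->
  d (m x y s) (m x y t) = `|s - t| * d x y.
Hypothesis ev_inj : injective ev.
Hypothesis ev_seg : forall x y (s : R) f, 0 <= s <= 1 ->
  ev (m x y s) f = ev x f + s * (ev y f - ev x f).

Let I0 : 0 <= (0 : R) <= 1. Proof. by rewrite lexx ler01. Qed.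
Let I1 : 0 <= (1 : R) <= 1. Proof. by rewrite lexx ler01. Qed.
Let Ih : 0 <= (2^-1 : R) <= 1. Proof. by lra. Qed.

Let d_ge0 x y : 0 <= d x y. Proof. by have [] := d_metric. Qed.
Let dC x y : d x y = d y x. Proof. by have [_ [_ []]] := d_metric. Qed.
Let d_tri y x z : d x z <= d x y + d y z.
Proof. by have [_ [_ []]] := d_metric. Qed.

Let evI x y : (forall f, ev x f = ev y f) -> x = y.
Proof. by move=> xy; apply/ev_inj/funext. Qed.

Let m0 x y : m x y 0 = x.
Proof. by apply: evI => f; rewrite ev_seg//; ring. Qed.

Let m1 x y : m x y 1 = y.
Proof. by apply: evI => f; rewrite ev_seg//; ring. Qed.

(* The segments from [x] to [x'] and from [y] to [y'] are parallel: the
   midpoints of the pairs at parameters [(a, b + e)] and [(a + e, b)] agree. *)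
Lemma parallelogram_eq x y x' y' :
  (forall f, ev y f - ev x f = ev y' f - ev x' f) -> d x y = d x' y'.
Proof.
move=> par.
pose D a b := d (m x x' a) (m y y' b).
have -> : d x y = D 0 0 by rewrite /D !m0.
have -> : d x' y' = D 1 1 by rewrite /D !m1.
apply: (@diagonal_const R D (d x x' + d y y')).
- move=> a b e Ia Ib Iae Ibe.
  pose z := m (m x x' a) (m y y' (b + e)) 2^-1.
  have zE : z = m (m x x' (a + e)) (m y y' b) 2^-1.
    apply: evI => f; rewrite !ev_seg//.
    have -> : ev y' f = ev y f - ev x f + ev x' f by rewrite par subrK.
    by field.
  have d1 : d (m x x' a) z = 2^-1 * D a (b + e).
    rewrite -{1}(m0 (m x x' a) (m y y' (b + e))) d_seg// sub0r normrN.
    by rewrite ger0_norm// invr_ge0.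
  have d2 : d z (m y y' b) = 2^-1 * D (a + e) b.
    rewrite zE -{2}(m1 (m x x' (a + e)) (m y y' b)) d_seg//.
    rewrite (_ : 2^-1 - 1 = - 2^-1); last by field.
    by rewrite normrN ger0_norm// invr_ge0.
  by have := d_tri z (m x x' a) (m y y' b); rewrite d1 d2 /D; lra.
- move=> a b a' b' Ia Ib Ia' Ib'; rewrite /D.
  have h1 := d_tri (m x x' a') (m x x' a) (m y y' b).
  have h2 := d_tri (m y y' b') (m x x' a') (m y y' b).
  rewrite (d_seg _ _ Ia Ia') in h1; rewrite (d_seg _ _ Ib' Ib) distrC in h2.
  have := mulr_ge0 (normr_ge0 (a - a')) (d_ge0 y y').
  have := mulr_ge0 (normr_ge0 (b - b')) (d_ge0 x x').
  by lra.
- exact: addr_ge0.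
Qed.

(** The part of the segment from [x] to [y] up to parameter [s] is parallel to the pair [x'], [y'],
    so translation invariance applies. *)
Lemma dilation_eq x y x' y' (s : R) : 0 <= s <= 1 ->
  (forall f, ev y' f - ev x' f = s * (ev y f - ev x f)) -> d x' y' = s * d x y.
Proof.
move=> Is par; rewrite (@parallelogram_eq x' y' x (m x y s)).
  by rewrite -{1}(m0 x y) d_seg// sub0r normrN ger0_norm//; case/andP: Is.
by move=> f; rewrite par ev_seg//; ring.
Qed.

(** Makes [cone_norm] independent of the representation. Dividing by the larger factor gives a ratio
    in [[0, 1]], as [dilation_eq] requires. *)
Lemma scaled_dist_eq (l l' : R) x y x' y' : 0 <= l -> 0 <= l' ->
  l *: (ev x - ev y) = l' *: (ev x' - ev y') -> l * d x y = l' * d x' y'.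
Proof.
wlog ll' : l l' x y x' y' / l <= l' => [H l0 l'0 eqv|].
  have [|/ltW] := leP l l'; first by move=> /H; apply.
  by move=> /H/(_ l'0 l0 (esym eqv))/esym.
move=> l0; rewrite le0r => /predU1P[l'E|l'0] eqv.
  by move: ll' l0 {eqv}; rewrite l'E => ? ?; rewrite (_ : l = 0) ?mul0r//; lra.
rewrite dC [d x' y']dC (@dilation_eq y x y' x' (l / l')).
- by field; exact: lt0r_neq0.
- by rewrite divr_ge0 ?(ltW l'0)//= ler_pdivrMr// mul1r.
move=> f; apply: (mulfI (lt0r_neq0 l'0)).
have <- : l * (ev x f - ev y f) = l' * (ev x' f - ev y' f).
  by have /= := congr1 (fun h : A -> R => h f) eqv.
by field; exact: lt0r_neq0.
Qed.

(** A linear subspace once [X] is inhabited, despite the name: swapping [x] and [y] negates, and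
    [cone_add_le] merges a sum into one multiple. *)
Definition cone : set (A -> R) :=
  [set v | exists (l : R) x y, 0 <= l /\ v = l *: (ev x - ev y)].

(** [xget] picks the value of some representation; all agree by [scaled_dist_eq]. Outside [cone] the
    value is [0]. *)
Definition cone_norm (v : A -> R) : R :=
  xget 0 [set r | exists (l : R) x y, [/\ 0 <= l, v = l *: (ev x - ev y) & r = l * d x y]].

Lemma cone_normE l x y : 0 <= l ->
  cone_norm (l *: (ev x - ev y)) = l * d x y.
Proof.
move=> l0; rewrite /cone_norm; case: xgetP => [r -> [l' [x' [y' [l'0 eqv ->]]]]|].
  by apply: scaled_dist_eq => //; exact/esym.
by move=> /(_ (l * d x y)); case; exists l, x, y.
Qed.

(** The points [a] and [b] divide the segments from [x] to [x'] and from [y] to [y'] at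
    [s = l' / (l + l')]. In the triangle inequality through [m y x' s], the legs are dilations of
    the pair [x], [y] by [1 - s] and of [x'], [y'] by [s]. *)
Lemma cone_add_le l x y l' x' y' : 0 <= l -> 0 <= l' ->
  exists a b, l *: (ev x - ev y) + l' *: (ev x' - ev y') =
    (l + l') *: (ev a - ev b) /\ (l + l') * d a b <= l * d x y + l' * d x' y'.
Proof.
move=> l0 l'0; pose s := l' / (l + l').
(* If [l + l' = 0], both factors vanish, and [s = 0] because the inverse of zero is zero. *)
have ls : (l + l') * s = l'.
  have [E|n0] := eqVneq (l + l') 0; last by rewrite /s mulrC divfK.
  by rewrite /s E mul0r; lra.
have Is : 0 <= s <= 1.
  rewrite divr_ge0 ?addr_ge0//=.
  have [E|n0] := eqVneq (l + l') 0; first by rewrite /s E invr0 mulr0.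
  by rewrite ler_pdivrMr ?mul1r ?lerDr// lt_def n0 addr_ge0.
have Is' : 0 <= 1 - s <= 1 by lra.
clearbody s.
exists (m x x' s), (m y y' s); split.
  apply/funext => f.
  change (l * (ev x f - ev y f) + l' * (ev x' f - ev y' f) =
    (l + l') * (ev (m x x' s) f - ev (m y y' s) f)).
  rewrite !ev_seg//; transitivity ((l + l') * (ev x f - ev y f) +
    (l + l') * s * (ev x' f - ev x f - (ev y' f - ev y f))); last by ring.
  by rewrite ls; ring.
have h := d_tri (m y x' s) (m x x' s) (m y y' s).
have d1 : d (m x x' s) (m y x' s) = (1 - s) * d x y.
  by apply: dilation_eq => // f; rewrite !ev_seg//; ring.
have d2 : d (m y x' s) (m y y' s) = s * d x' y'.
  by apply: dilation_eq => // f; rewrite !ev_seg//; ring.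
rewrite d1 d2 in h; have := ler_wpM2l (addr_ge0 l0 l'0) h.
move/le_trans; apply; rewrite mulrDr !mulrA mulrBr mulr1 ls.
by rewrite addrK.
Qed.

Lemma cone_add u v : cone u -> cone v -> cone (u + v).
Proof.
move=> [l [x [y [l0 ->]]]] [l' [x' [y' [l'0 ->]]]].
have [a [b [-> _]]] := cone_add_le x y x' y' l0 l'0.
by exists (l + l'), a, b; split => //; exact: addr_ge0.
Qed.

Lemma cone_scale (c : R) u : cone u -> cone (c *: u).
Proof.
move=> [l [x [y [l0 ->]]]]; have [c0|c0] := leP 0 c.
  by exists (c * l), x, y; rewrite mulr_ge0// scalerA.
exists (- c * l), y, x; split; first by rewrite mulr_ge0// oppr_ge0 ltW.
by rewrite scalerA mulNr scaleNr -scalerN opprB.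
Qed.

Lemma sublinear_cone_norm : sublinear_on cone cone_norm.
Proof.
split=> [_ _ [l [x [y [l0 ->]]]] [l' [x' [y' [l'0 ->]]]]|c _ c0 [l [x [y [l0 ->]]]]].
  have [a [b [-> h]]] := cone_add_le x y x' y' l0 l'0.
  by rewrite !cone_normE// addr_ge0.
by rewrite scalerA !cone_normE ?mulr_ge0// mulrA.
Qed.

(** Hahn-Banach is applied at [ev a - ev b]. Subtracting [ev b] keeps all arguments in [cone], the
    set on which [L] is known to be linear. *)
Lemma affine_norming_function a b : exists f : X -> R,
  [/\ forall x y (s : R), 0 <= s <= 1 -> f (m x y s) = f x + s * (f y - f x),
      forall x y, f x - f y <= d x y & f a - f b = d a b].
Proof.
have cone_sub x y : cone (ev x - ev y).
  by exists 1, x, y; rewrite ler01 scale1r.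
have normE x y : cone_norm (ev x - ev y) = d x y.
  by have := cone_normE x y ler01; rewrite scale1r mul1r.
have [L [LD LZ Lle Lab]] :=
  hahn_banach cone_add cone_scale sublinear_cone_norm (cone_sub a b).
have LB x y : L (ev x - ev b) - L (ev y - ev b) = L (ev x - ev y).
  have -> : ev x - ev b = (ev x - ev y) + (ev y - ev b) by rewrite addrA subrK.
  by rewrite LD// addrK.
exists (fun x => L (ev x - ev b)); split=> [x y s Is|x y|].
- rewrite LB -LZ// -LD//; last exact: cone_scale.
  congr L; apply/funext => f.
  change (ev (m x y s) f - ev b f =
    ev x f - ev b f + s * (ev y f - ev x f)).
  by rewrite ev_seg//; ring.
- by rewrite LB -normE; exact: Lle.
- by rewrite LB Lab normE.
Qed.

End AffineMetric.

(** * Affine maps on a space with a bicombing, and the equivalences *)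

Section Bicombing.
Context {R : realType} {X : Type} {d : X -> X -> R} {g : X -> X -> R -> X}.
Hypothesis d_metric : is_metric d.
Hypothesis g_bicombing : is_bicombing d g.

Let d_ge0 x y : 0 <= d x y. Proof. by have [] := d_metric. Qed.

(** If [F x <> F y], the endpoints force [b = 0] and [a * d x y = |F y - F x|]. If [F x = F y], the
    natural geodesic is constant and both sides equal [F x]. *)
Lemma affine_mapP (V : normedModType R) (F : X -> V) :
  affine_map d g (@norm_dist R V) (@natural_bicombing R V) F <->
  forall x y (s : R), 0 <= s <= 1 ->
    F (g x y (s * d x y)) = F x + s *: (F y - F x).
Proof.
have [gE _] := g_bicombing.
rewrite /affine_map /norm_dist /natural_bicombing; split=> H x y.
  move=> s /andP[s0 s1]; have [a [b Hab]] := H x y.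
  have sd : 0 <= s * d x y <= d x y.
    by rewrite mulr_ge0//= -[leRHS]mul1r ler_wpM2r.
  have [_ ->] := Hab _ sd.
  have [FE|FN] := eqVneq (F y - F x) 0; first by rewrite FE !scaler0.
  have N0 : `|F y - F x| != 0 by rewrite normr_eq0.
  have scale_inj (u v : R) : u *: (F y - F x) = v *: (F y - F x) -> u = v.
    move=> /eqP; rewrite -subr_eq0 -scalerBl scaler_eq0 (negPf FN) orbF subr_eq0.
    by move/eqP.
  have [gx gy] := gE x y.
  have b0 : b = 0.
    have [|_] := Hab 0; first by rewrite lexx d_ge0.
    rewrite gx mulr0 add0r -{1}[F x]addr0 => /addrI.
    rewrite -[X in X = _ -> _](scale0r (F y - F x)) => /scale_inj/esym/eqP.
    by rewrite mulf_eq0 invr_eq0 (negPf N0) orbF => /eqP.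
  have ad : a * d x y = `|F y - F x|.
    have [|_] := Hab (d x y); first by rewrite lexx d_ge0.
    rewrite gy b0 addr0 -{1}[F y](subrK (F x)) addrC => /addrI.
    rewrite -[X in X = _ -> _]scale1r => /scale_inj.
    by move/(congr1 (fun r => r * `|F y - F x|)); rewrite mul1r divfK.
  by congr (_ + _ *: _); rewrite b0 addr0 mulrCA ad mulfK.
exists (`|F y - F x| / d x y), 0 => t /andP[t0 td].
pose s := t / d x y.
have tE : t = s * d x y.
  have [d0|d0] := eqVneq (d x y) 0; last by rewrite /s divfK.
  by rewrite d0 mulr0; apply/eqP; rewrite eq_le t0 andbT -d0.
have Is : 0 <= s <= 1.
  rewrite /s divr_ge0//=; have [d0|d0] := eqVneq (d x y) 0.
    by rewrite d0 invr0 mulr0.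
  by rewrite ler_pdivrMr ?mul1r// lt_def d0 d_ge0.
have aE : `|F y - F x| / d x y * t = s * `|F y - F x|.
  by rewrite /s; ring.
rewrite addr0 aE distrC; move: (Is) => /andP[s0 s1]; split.
  rewrite mulr_ge0//= -[leRHS]mul1r distrC; exact: ler_wpM2r.
rewrite tE H//; have [->|FN] := eqVneq (F y - F x) 0; first by rewrite !scaler0.
by rewrite distrC mulfK// normr_eq0.
Qed.

(** A linear functional attaining the norm at [f x - f x'] separates the two images, and composing
    with it preserves the formula of [affine_mapP]. *)
Lemma separating_of_injective (B : normedModType R) (f : X -> B) :
  injective f -> affine_map d g (@norm_dist R B) (@natural_bicombing R B) f ->
  forall x x', x <> x' -> exists h : X -> R^o,
    affine_map d g (@norm_dist R R^o) (@natural_bicombing R R^o) h /\ h x <> h x'.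
Proof.
move=> f_inj /affine_mapP f_aff x x' xx'.
have norm_sub : sublinear_on [set: B] (fun v => `|v|).
  split=> [u v _ _|a u a0 _]; first exact: ler_normD.
  by rewrite normrZ ger0_norm.
have [L [LD LZ _ Lx]] := @hahn_banach R B [set: B] (fun _ _ _ _ => I)
  (fun _ _ _ => I) _ (f x - f x') norm_sub I.
have LB u v : L (u - v) = L u - L v by rewrite LD// -scaleN1r LZ// mulN1r.
exists (L \o f); split.
  by apply/affine_mapP => y z s Is /=; rewrite f_aff// LD// LZ// LB.
move=> /= E; apply: xx'; apply: f_inj; apply/eqP; rewrite -subr_eq0 -normr_eq0.
by rewrite -Lx LB E subrr.
Qed.

(** The coordinates are norming functions indexed by pairs of points, shifted to vanish at [x0] and
    hence bounded by [d x x0] at [x]. Being 1-Lipschitz, they give [|f x - f y| <= d x y]; the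
    coordinate [(x, y)] gives equality. *)
Lemma isometric_of_separating :
  (forall x x', x <> x' -> exists f : X -> R^o,
     affine_map d g (@norm_dist R R^o) (@natural_bicombing R R^o) f /\
     f x <> f x') ->
  exists (B : completeNormedModType R) (f : X -> B),
    injective f /\ (forall x y, `|f x - f y| = d x y) /\
    affine_map d g (@norm_dist R B) (@natural_bicombing R B) f.
Proof.
move=> sep; have [_ [d_eq0 [dC _]]] := d_metric.
have [_ [gd _]] := g_bicombing.
pose A := {f : X -> R^o |
  affine_map d g (@norm_dist R R^o) (@natural_bicombing R R^o) f}.
pose ev (x : X) (f : A) : R := sval f x.
pose m x y (s : R) := g x y (s * d x y).
have d_seg x y (s t : R) : 0 <= s <= 1 -> 0 <= t <= 1 ->
    d (m x y s) (m x y t) = `|s - t| * d x y.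
  move=> /andP[s0 s1] /andP[t0 t1]; rewrite /m gd.
  - by rewrite -mulrBl normrM [`|d x y|]ger0_norm.
  - by rewrite mulr_ge0//= -[leRHS]mul1r ler_wpM2r.
  - by rewrite mulr_ge0//= -[leRHS]mul1r ler_wpM2r.
have ev_inj : injective ev.
  move=> x y xy; apply: contrapT => /sep[f [fa]]; apply.
  by have /= := congr1 (fun h : A -> R => h (exist _ f fa)) xy.
have ev_seg x y (s : R) f : 0 <= s <= 1 ->
    ev (m x y s) f = ev x f + s * (ev y f - ev x f).
  by move=> Is; case: f => f fa; have /affine_mapP/(_ x y s Is) := fa.
have /choice[F FP] : forall ab : X * X, exists f : X -> R,
    [/\ forall x y (s : R), 0 <= s <= 1 -> f (m x y s) = f x + s * (f y - f x),
      forall x y, f x - f y <= d x y & f ab.1 - f ab.2 = d ab.1 ab.2].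
  by move=> [a b]; exact: affine_norming_function d_metric d_seg ev_inj ev_seg a b.
(* An empty [X] has no base point; any Banach space then serves. *)
have [[x0]|nX] := pselect (inhabited X); last first.
  exists (ell_infty R unit), (fun=> 0); split=> [x|]; first by case: nX.
  by split=> x; case: nX.
have F_lip ab x y : `|F ab x - F ab y| <= d x y.
  by have [_ Fle _] := FP ab; rewrite ler_norml lerNl opprB Fle {1}dC Fle.
have Fb x : bounded_function (fun ab => F ab x - F ab x0).
  by apply/asboolP; exists (d x x0) => ab.
pose f x : ell_infty R (X * X) := Sub _ (Fb x).
have f_sub x y ab : val (f x - f y) ab = F ab x - F ab y.
  change (F ab x - F ab x0 - (F ab y - F ab x0) = F ab x - F ab y).
  by ring.
have f_iso x y : `|f x - f y| = d x y.
  apply/eqP; rewrite eq_le; apply/andP; split.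
    apply: sup_norm_le => // ab.
    by rewrite f_sub.
  have [_ _ Fxy] := FP (x, y).
  have := sup_norm_ub (f x - f y) (x, y); apply: le_trans.
  by rewrite f_sub Fxy ger0_norm.
exists (ell_infty R (X * X)), f; split.
  by move=> x y xy; apply/d_eq0; rewrite -f_iso xy subrr normr0.
split=> //; apply/affine_mapP => x y s Is; apply/val_inj/funext => ab.
have [Fa _ _] := FP ab.
change (F ab (m x y s) - F ab x0 =
  F ab x - F ab x0 + s * ((F ab y - F ab x0) - (F ab x - F ab x0))).
by rewrite Fa//; ring.
Qed.

End Bicombing.

Theorem theorem1p8 (R : realType) (X : Type) (d : X -> X -> R)
  (g : X -> X -> R -> X) (hd : is_metric d) (hg : is_bicombing d g) :
  ((exists (B : completeNormedModType R) (f : X -> B),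
       injective f /\ (forall x y, `|f x - f y| = d x y) /\
       affine_map d g (@norm_dist R B) (@natural_bicombing R B) f)
   <->
   (forall x x', x <> x' -> exists f : X -> R^o,
       affine_map d g (@norm_dist R R^o) (@natural_bicombing R R^o) f /\
       f x <> f x'))
  /\
  ((forall x x', x <> x' -> exists f : X -> R^o,
       affine_map d g (@norm_dist R R^o) (@natural_bicombing R R^o) f /\
       f x <> f x')
   <->
   (exists (B : completeNormedModType R) (f : X -> B),
       injective f /\
       affine_map d g (@norm_dist R B) (@natural_bicombing R B) f)).
Proof.
split; split.
- by move=> [B [f [f_inj [_ f_aff]]]]; exact: separating_of_injective f_aff.
- exact: isometric_of_separating.
- move=> /(isometric_of_separating hd hg)[B [f [f_inj [_ f_aff]]]].
  by exists B, f.
- by move=> [B [f [f_inj f_aff]]]; exact: separating_of_injective f_aff.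
Qed.
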